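(* Let $TM=D\oplus D^{\bot}$ with $\dim D=n\geq 3$, and let $M$ be a Riemannian manifold of constant sectional curvature $c$ endowed with the semi-symmetric metric connection $\widetilde{\nabla}$. Then for every $2$-plane $\Pi\subset D$ (at any point of $M$), $$\widetilde{\tau}^D-\widetilde{K}^D(\Pi)\leq \frac{(n+1)(n-2)}{2}c-(n-1)\lambda+A^D+\Omega^{\Pi}+\frac{n^2(n-2)}{2(n-1)}\|\widetilde{H}\|^2+\frac{1}{2}\|\widetilde{B}\|^2.$$
   Context: $(M,g)$ is a smooth Riemannian manifold with Levi-Civita connection $\nabla$. $D\subseteq TM$ is a smooth subbundle (distribution) of constant rank $n$ that is non integrable, i.e. there are $X,Y\in\Gamma(D)$ with $[X,Y]\notin\Gamma(D)$. $D^\bot$ is its orthogonal complement, $\pi^D:TM\to D$ and $\pi^{D^\bot}:TM\to D^\bot$ are the orthogonal projections, $[X,Y]^D=\pi^D[X,Y]$, $[X,Y]^{D^\bot}=\pi^{D^\bot}[X,Y]$. For $X,Y\in\Gamma(D)$, $B(X,Y)=\pi^{D^\bot}(\nabla_XY)$. $U$ is a vector field on $M$, $\omega(V)=g(U,V)$. The semi-symmetric metric connection on $M$ is $\widetilde\nabla_XY=\nabla_XY+\omega(Y)X-g(X,Y)U$. For $X,Y\in\Gamma(D)$ put $\widetilde\nabla^D_XY=\pi^D(\widetilde\nabla_XY)$, $\widetilde B(X,Y)=\pi^{D^\bot}(\widetilde\nabla_XY)$, and $$\widetilde R^D(X,Y)Z=\widetilde\nabla^D_X\widetilde\nabla^D_YZ-\widetilde\nabla^D_Y\widetilde\nabla^D_XZ-\widetilde\nabla^D_{[X,Y]^D}Z-\pi^D[[X,Y]^{D^\bot},Z],$$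 which is tensorial, with $\widetilde R^D(X,Y,Z,W)=g(\widetilde R^D(X,Y)Z,W)$. Let $\{E_1,\dots,E_n\}$ be a local orthonormal frame of $D$, chosen (when $\Pi$ occurs) so that $E_1,E_2$ is an orthonormal basis of $\Pi$ at the point considered. Define $\widetilde K^D(\Pi)=\frac12[\widetilde R^D(E_1,E_2,E_2,E_1)-\widetilde R^D(E_1,E_2,E_1,E_2)]$; $\widetilde\tau^D=\frac12\sum_{1\le i,j\le n}\widetilde R^D(E_i,E_j,E_j,E_i)$; $\widetilde H=\frac1n\sum_{i=1}^n\widetilde B(E_i,E_i)$; $\|\widetilde B\|^2=\sum_{i,j=1}^n g(\widetilde B(E_i,E_j),\widetilde B(E_i,E_j))$; $\alpha(X,Y)=(\nabla_X\omega)(Y)-\omega(X)\omega(Y)+\frac12 g(X,Y)\omega(U)$; $\lambda=\sum_{j=1}^n\alpha(E_j,E_j)$; $A^D=\frac12\sum_{1\le i,j\le n}g(B(E_j,E_i),[E_j,E_i])$; $\Omega^\Pi=\alpha(E_1,E_1)+\alpha(E_2,E_2)-\frac12 g(B(E_1,E_2)-B(E_2,E_1),[E_1,E_2])$. These are independent of the choice of orthonormal bases. *)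

(* Defs.v *)
From HB Require Import structures.
From mathcomp Require Import all_boot all_order all_algebra.
From mathcomp Require Import all_classical all_reals.
From mathcomp Require Import topology normedtype derive.

Set Implicit Arguments.
Unset Strict Implicit.
Unset Printing Implicit Defensive.

Import Order.TTheory GRing.Theory Num.Theory.
Import numFieldNormedType.Exports.

Local Open Scope classical_set_scope.
Local Open Scope ring_scope.

(** * Smooth functions on open subsets of R^m *)

Fixpoint Ck_on (R : realType) (m : nat) (V : normedModType R) (k : nat)
    (O : set 'rV[R]_m) (f : 'rV[R]_m -> V) : Prop :=
  (forall x, O x -> {for x, continuous f}) /\
  match k with
  | 0 => True
  | k'.+1 => forall i : 'I_m,
      (forall x, O x -> derivable f x (delta_mx 0 i)) /\
      Ck_on k' O ('D_(delta_mx 0 i) f)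
  end.

Definition smooth_on (R : realType) (m : nat) (V : normedModType R)
    (O : set 'rV[R]_m) (f : 'rV[R]_m -> V) : Prop :=
  forall k, Ck_on k O f.

(** * Smooth manifolds *)

(* The inverse of a chart is a total function of which only the values on
   [chart_cod] matter. *)
Record chart (R : realType) (m : nat) (T : topologicalType) := Chart {
  chart_dom : set T;
  chart_cod : set 'rV[R]_m;
  chart_map : T -> 'rV[R]_m;
  chart_inv : 'rV[R]_m -> T;
  chart_dom_open : open chart_dom;
  chart_cod_open : open chart_cod;
  chart_map_cod : forall p, chart_dom p -> chart_cod (chart_map p);
  chart_inv_dom : forall x, chart_cod x -> chart_dom (chart_inv x);
  chart_mapK : forall p, chart_dom p -> chart_inv (chart_map p) = p;
  chart_invK : forall x, chart_cod x -> chart_map (chart_inv x) = x;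
  chart_map_continuous :
    forall p, chart_dom p -> {for p, continuous chart_map};
  chart_inv_continuous :
    forall x, chart_cod x -> {for x, continuous chart_inv} }.

(* The part of the coordinate domain of [c] lying over the set [A]. *)
Definition chart_over (R : realType) (m : nat) (T : topologicalType)
    (c : chart R m T) (A : set T) : set 'rV[R]_m :=
  chart_cod c `&` chart_inv c @^-1` A.

Record smooth_manifold (R : realType) (m : nat) := SmoothManifold {
  carrier :> topologicalType;
  carrier_hausdorff : hausdorff_space carrier;
  carrier_second_countable : @second_countable carrier;
  atlas : set (chart R m carrier);
  atlas_cover : forall p : carrier, exists2 c, atlas c & chart_dom c p;
  atlas_smooth : forall c c', atlas c -> atlas c' ->
    smooth_on (chart_over c (chart_dom c')) (chart_map c' \o chart_inv c) }.

(* A chosen chart of the atlas around each point.  The tangent space at [p] is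
   represented by 'rV[R]_m: a row vector stands for the tangent vector that has
   these components in the chart [chart_at p].  As [chart_at] need not vary
   continuously, regularity of a vector field is never read off its components
   directly, but after a change of coordinates to a fixed chart. *)
Definition chart_at (R : realType) (m : nat) (M : smooth_manifold R m) (p : M)
    : chart R m M :=
  s2val (cid2 (atlas_cover p)).

Definition chart_pt (R : realType) (m : nat) (M : smooth_manifold R m) (p : M)
    : 'rV[R]_m :=
  chart_map (chart_at p) p.

(* Components in the chart [c] of the tangent vector [v] at [p]. *)
Definition tangent_coord (R : realType) (m : nat) (M : smooth_manifold R m)
    (c : chart R m M) (p : M) (v : 'rV[R]_m) : 'rV[R]_m :=
  'D_v (chart_map c \o chart_inv (chart_at p)) (chart_pt p).

Definition vfield (R : realType) (m : nat) (M : smooth_manifold R m) :=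
  M -> 'rV[R]_m.

Definition vfield_in_chart (R : realType) (m : nat) (M : smooth_manifold R m)
    (c : chart R m M) (X : vfield M) : 'rV[R]_m -> 'rV[R]_m :=
  fun x => tangent_coord c (chart_inv c x) (X (chart_inv c x)).

Definition smooth_fun_on (R : realType) (m : nat) (M : smooth_manifold R m)
    (W : set M) (f : M -> R) : Prop :=
  forall c, atlas c -> smooth_on (chart_over c W) (f \o chart_inv c).

(* Vector fields are total functions; a local vector field on an open set [W]
   is one that is smooth on [W], its values elsewhere being irrelevant. *)
Definition smooth_vfield_on (R : realType) (m : nat) (M : smooth_manifold R m)
    (W : set M) (X : vfield M) : Prop :=
  forall c, atlas c -> smooth_on (chart_over c W) (vfield_in_chart c X).

(* The derivative X(f). *)
Definition vderive (R : realType) (m : nat) (M : smooth_manifold R m)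
    (X : vfield M) (f : M -> R) : M -> R :=
  fun p => 'D_(X p) (f \o chart_inv (chart_at p)) (chart_pt p).

(* [X, Y]^i = X^j d_j Y^i - Y^j d_j X^i, computed at [p] in [chart_at p]. *)
Definition lie_bracket (R : realType) (m : nat) (M : smooth_manifold R m)
    (X Y : vfield M) : vfield M :=
  fun p => 'D_(X p) (vfield_in_chart (chart_at p) Y) (chart_pt p)
         - 'D_(Y p) (vfield_in_chart (chart_at p) X) (chart_pt p).

(** * Riemannian metrics and connections *)

(* [G] gives the Gram matrix at [p] in the coordinates of [chart_at p]. *)
Definition inner (R : realType) (m : nat) (M : smooth_manifold R m)
    (G : M -> 'M[R]_m) (p : M) (u v : 'rV[R]_m) : R :=
  (u *m G p *m v^T) 0 0.

Record riemannian_metric (R : realType) (m : nat) (M : smooth_manifold R m) :=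
  RiemannianMetric {
  gram :> M -> 'M[R]_m;
  gram_sym : forall p, (gram p)^T = gram p;
  gram_pos : forall p v, v != 0 -> 0 < inner gram p v v;
  gram_smooth : forall (W : set M) (X Y : vfield M), open W ->
    smooth_vfield_on W X -> smooth_vfield_on W Y ->
    smooth_fun_on W (fun q => inner gram q (X q) (Y q)) }.

Definition metric_of (R : realType) (m : nat) (M : smooth_manifold R m)
    (g : riemannian_metric M) (X Y : vfield M) : M -> R :=
  fun p => inner g p (X p) (Y p).

(* A connection is used together with its restrictions to open sets: [nab X Y]
   has a meaning on [W] as soon as [X] and [Y] are smooth on [W]. *)
Record affine_connection (R : realType) (m : nat) (M : smooth_manifold R m)
    (nab : vfield M -> vfield M -> vfield M) : Prop := AffineConnection {
  conn_smooth : forall (W : set M) (X Y : vfield M), open W ->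
    smooth_vfield_on W X -> smooth_vfield_on W Y ->
    smooth_vfield_on W (nab X Y);
  conn_addl : forall (W : set M) (X X' Y : vfield M), open W ->
    smooth_vfield_on W X -> smooth_vfield_on W X' -> smooth_vfield_on W Y ->
    forall p, W p -> nab (fun q => X q + X' q) Y p = nab X Y p + nab X' Y p;
  conn_scalel : forall (W : set M) (f : M -> R) (X Y : vfield M), open W ->
    smooth_fun_on W f -> smooth_vfield_on W X -> smooth_vfield_on W Y ->
    forall p, W p -> nab (fun q => f q *: X q) Y p = f p *: nab X Y p;
  conn_addr : forall (W : set M) (X Y Y' : vfield M), open W ->
    smooth_vfield_on W X -> smooth_vfield_on W Y -> smooth_vfield_on W Y' ->
    forall p, W p -> nab X (fun q => Y q + Y' q) p = nab X Y p + nab X Y' p;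
  conn_leibniz : forall (W : set M) (f : M -> R) (X Y : vfield M), open W ->
    smooth_fun_on W f -> smooth_vfield_on W X -> smooth_vfield_on W Y ->
    forall p, W p ->
      nab X (fun q => f q *: Y q) p = vderive X f p *: Y p + f p *: nab X Y p }.

Definition torsion_free (R : realType) (m : nat) (M : smooth_manifold R m)
    (nab : vfield M -> vfield M -> vfield M) : Prop :=
  forall (W : set M) (X Y : vfield M), open W ->
    smooth_vfield_on W X -> smooth_vfield_on W Y ->
    forall p, W p -> nab X Y p - nab Y X p = lie_bracket X Y p.

Definition metric_compatible (R : realType) (m : nat) (M : smooth_manifold R m)
    (g : riemannian_metric M) (nab : vfield M -> vfield M -> vfield M) : Prop :=
  forall (W : set M) (X Y Z : vfield M), open W ->
    smooth_vfield_on W X -> smooth_vfield_on W Y -> smooth_vfield_on W Z ->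
    forall p, W p -> vderive X (metric_of g Y Z) p =
      metric_of g (nab X Y) Z p + metric_of g Y (nab X Z) p.

Definition levi_civita (R : realType) (m : nat) (M : smooth_manifold R m)
    (g : riemannian_metric M) (nab : vfield M -> vfield M -> vfield M) : Prop :=
  [/\ affine_connection nab, torsion_free nab & metric_compatible g nab].

Definition curvature (R : realType) (m : nat) (M : smooth_manifold R m)
    (nab : vfield M -> vfield M -> vfield M) (X Y Z : vfield M) : vfield M :=
  fun p => nab X (nab Y Z) p - nab Y (nab X Z) p - nab (lie_bracket X Y) Z p.

Definition sectional_curvature (R : realType) (m : nat)
    (M : smooth_manifold R m) (g : riemannian_metric M)
    (nab : vfield M -> vfield M -> vfield M) (X Y : vfield M) (p : M) : R :=
  metric_of g (curvature nab X Y Y) X p /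
  (metric_of g X X p * metric_of g Y Y p - metric_of g X Y p ^+ 2).

Definition constant_sectional_curvature (R : realType) (m : nat)
    (M : smooth_manifold R m) (g : riemannian_metric M)
    (nab : vfield M -> vfield M -> vfield M) (c : R) : Prop :=
  forall (W : set M) (X Y : vfield M), open W ->
    smooth_vfield_on W X -> smooth_vfield_on W Y ->
    forall p, W p -> free [:: X p; Y p] ->
      sectional_curvature g nab X Y p = c.

(** * Distributions *)

(* The fibre at [p] is the row space of [fibre p]. *)
Record tangent_subbundle (R : realType) (m : nat) (M : smooth_manifold R m)
    (n : nat) := TangentSubbundle {
  fibre :> M -> 'M[R]_m;
  fibre_rank : forall p, \rank (fibre p) = n;
  fibre_smooth : forall p, exists W : set M, exists E : 'I_n -> vfield M,
    [/\ open_nbhs p W, forall i, smooth_vfield_on W (E i) &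
        forall q, W q -> (\matrix_(i < n) E i q == fibre q)%MS] }.

Definition section_on (R : realType) (m n : nat) (M : smooth_manifold R m)
    (D : tangent_subbundle M n) (W : set M) (X : vfield M) : Prop :=
  smooth_vfield_on W X /\ forall p, W p -> (X p <= D p)%MS.

Definition non_integrable (R : realType) (m n : nat) (M : smooth_manifold R m)
    (D : tangent_subbundle M n) : Prop :=
  exists X Y : vfield M, [/\ section_on D setT X, section_on D setT Y &
    ~ section_on D setT (lie_bracket X Y)].

Definition orthogonal_fibre (R : realType) (m n : nat)
    (M : smooth_manifold R m) (g : riemannian_metric M)
    (D : tangent_subbundle M n)
    (p : M) : 'M[R]_m :=
  kermx (g p *m (D p)^T).

Definition projD (R : realType) (m n : nat) (M : smooth_manifold R m)
    (g : riemannian_metric M) (D : tangent_subbundle M n) (X : vfield M)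
    : vfield M :=
  fun p => X p *m proj_mx (D p) (orthogonal_fibre g D p).

Definition projDperp (R : realType) (m n : nat) (M : smooth_manifold R m)
    (g : riemannian_metric M) (D : tangent_subbundle M n) (X : vfield M)
    : vfield M :=
  fun p => X p *m proj_mx (orthogonal_fibre g D p) (D p).

Definition orthonormal_frame_on (R : realType) (m n : nat)
    (M : smooth_manifold R m) (g : riemannian_metric M)
    (D : tangent_subbundle M n)
    (W : set M) (E : 'I_n -> vfield M) : Prop :=
  (forall i, section_on D W (E i)) /\
  forall p, W p -> forall i j, metric_of g (E i) (E j) p = (i == j)%:R.

(** * Semi-symmetric metric connection and induced objects on D *)

Definition oneform (R : realType) (m : nat) (M : smooth_manifold R m)
    (g : riemannian_metric M) (U V : vfield M) : M -> R :=
  metric_of g U V.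

Definition semi_symmetric (R : realType) (m : nat) (M : smooth_manifold R m)
    (g : riemannian_metric M) (nab : vfield M -> vfield M -> vfield M)
    (U : vfield M) (X Y : vfield M) : vfield M :=
  fun p => nab X Y p + oneform g U Y p *: X p - metric_of g X Y p *: U p.

(* For a connection [nab] on M: the connection pi^D(nab_X Y) induced on D, the
   second fundamental form pi^{D^perp}(nab_X Y) and the curvature tensor of
   the induced connection.  They are used both for the Levi-Civita connection
   and for the semi-symmetric one. *)
Definition induced_connection (R : realType) (m n : nat)
    (M : smooth_manifold R m) (g : riemannian_metric M)
    (D : tangent_subbundle M n)
    (nab : vfield M -> vfield M -> vfield M) (X Y : vfield M) : vfield M :=
  projD g D (nab X Y).

Definition second_form (R : realType) (m n : nat)
    (M : smooth_manifold R m) (g : riemannian_metric M)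
    (D : tangent_subbundle M n)
    (nab : vfield M -> vfield M -> vfield M) (X Y : vfield M) : vfield M :=
  projDperp g D (nab X Y).

Definition curvatureD (R : realType) (m n : nat)
    (M : smooth_manifold R m) (g : riemannian_metric M)
    (D : tangent_subbundle M n)
    (nab : vfield M -> vfield M -> vfield M) (X Y Z : vfield M) : vfield M :=
  let nabD := induced_connection g D nab in
  fun p => nabD X (nabD Y Z) p - nabD Y (nabD X Z) p
         - nabD (projD g D (lie_bracket X Y)) Z p
         - projD g D (lie_bracket (projDperp g D (lie_bracket X Y)) Z) p.

Definition curvatureD4 (R : realType) (m n : nat)
    (M : smooth_manifold R m) (g : riemannian_metric M)
    (D : tangent_subbundle M n)
    (nab : vfield M -> vfield M -> vfield M) (X Y Z W : vfield M) : M -> R :=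
  metric_of g (curvatureD g D nab X Y Z) W.

(* K^D of the plane spanned by the orthonormal pair E1, E2. *)
Definition planeK (R : realType) (m n : nat)
    (M : smooth_manifold R m) (g : riemannian_metric M)
    (D : tangent_subbundle M n)
    (nab : vfield M -> vfield M -> vfield M) (E1 E2 : vfield M) (p : M) : R :=
  (curvatureD4 g D nab E1 E2 E2 E1 p - curvatureD4 g D nab E1 E2 E1 E2 p) / 2.

Definition scalarD (R : realType) (m n : nat)
    (M : smooth_manifold R m) (g : riemannian_metric M)
    (D : tangent_subbundle M n)
    (nab : vfield M -> vfield M -> vfield M) (E : 'I_n -> vfield M) (p : M)
    : R :=
  (\sum_(i < n) \sum_(j < n)
     curvatureD4 g D nab (E i) (E j) (E j) (E i) p) / 2.

Definition mean_curvature (R : realType) (m n : nat)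
    (M : smooth_manifold R m) (g : riemannian_metric M)
    (D : tangent_subbundle M n)
    (nab : vfield M -> vfield M -> vfield M) (E : 'I_n -> vfield M)
    : vfield M :=
  fun p => n%:R^-1 *: \sum_(i < n) second_form g D nab (E i) (E i) p.

Definition second_form_normsq (R : realType) (m n : nat)
    (M : smooth_manifold R m) (g : riemannian_metric M)
    (D : tangent_subbundle M n)
    (nab : vfield M -> vfield M -> vfield M) (E : 'I_n -> vfield M) (p : M)
    : R :=
  \sum_(i < n) \sum_(j < n)
    metric_of g (second_form g D nab (E i) (E j))
                (second_form g D nab (E i) (E j)) p.

(* (nabla_X omega)(Y) = X(omega(Y)) - omega(nabla_X Y). *)
Definition nabla_oneform (R : realType) (m : nat) (M : smooth_manifold R m)
    (g : riemannian_metric M) (nab : vfield M -> vfield M -> vfield M)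
    (U X Y : vfield M) : M -> R :=
  fun p => vderive X (oneform g U Y) p - oneform g U (nab X Y) p.

Definition alpha (R : realType) (m : nat) (M : smooth_manifold R m)
    (g : riemannian_metric M) (nab : vfield M -> vfield M -> vfield M)
    (U X Y : vfield M) : M -> R :=
  fun p => nabla_oneform g nab U X Y p - oneform g U X p * oneform g U Y p
         + metric_of g X Y p * oneform g U U p / 2.

Definition lambda (R : realType) (m n : nat) (M : smooth_manifold R m)
    (g : riemannian_metric M) (nab : vfield M -> vfield M -> vfield M)
    (U : vfield M) (E : 'I_n -> vfield M) (p : M) : R :=
  \sum_(j < n) alpha g nab U (E j) (E j) p.

Definition AD (R : realType) (m n : nat) (M : smooth_manifold R m)
    (g : riemannian_metric M) (D : tangent_subbundle M n)
    (nab : vfield M -> vfield M -> vfield M) (E : 'I_n -> vfield M) (p : M)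
    : R :=
  (\sum_(i < n) \sum_(j < n)
     metric_of g (second_form g D nab (E j) (E i))
                 (lie_bracket (E j) (E i)) p) / 2.

Definition OmegaPlane (R : realType) (m n : nat) (M : smooth_manifold R m)
    (g : riemannian_metric M) (D : tangent_subbundle M n)
    (nab : vfield M -> vfield M -> vfield M) (U E1 E2 : vfield M) (p : M) : R :=
  let B := second_form g D nab in
  alpha g nab U E1 E1 p + alpha g nab U E2 E2 p
  - metric_of g (fun q => B E1 E2 q - B E2 E1 q) (lie_bracket E1 E2) p / 2.

(* Main.v *)
Require Import Defs.
From HB Require Import structures.
From mathcomp Require Import all_boot all_order all_algebra.
From mathcomp Require Import all_classical all_reals.
From mathcomp Require Import topology normedtype derive.
From mathcomp Require Import realfun ring lra.
Import Order.TTheory GRing.Theory Num.Theory.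
Import numFieldNormedType.Exports.
Local Open Scope classical_set_scope.
Local Open Scope ring_scope.

(** Write N for the semi-symmetric connection, B and B' for the second
fundamental forms of D with respect to nabla and N, and al for [alpha].  N is
compatible with g, so differentiating the identity g(V^perp, E_k) = 0 along D
compares the induced curvature with the ambient one:
<<
  R^D(X,Y,Z,V) = R^N(X,Y,Z,V) + g(B'(Y,Z), B'(X,V)) - g(B'(X,Z), B'(Y,V))
                 - g(B(Z,V), [X,Y])
>>
([gauss_equation]).  The bracket term appears because D is not integrable: it
is what the correction pi^D[[X,Y]^perp, Z] leaves after torsion-freeness turns
it into covariant derivatives of nabla; here N_V Z and nabla_V Z have the same
D-component, for V normal and Z tangent to D.  Expanding N in terms of nabla
gives
<<
  R^N(X,Y,Z,V) = R(X,Y,Z,V) - al(Y,Z) g(X,V) + al(X,Z) g(Y,V)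
                 - g(Y,Z) al(X,V) + g(X,Z) al(Y,V)
>>
([curvature_semi_symmetric]).  On an orthonormal frame of D, where R is known
on coordinate planes from the sectional curvature alone, summation gives tau
and K exactly, and everything cancels from the claim except
<<
  |S|^2 / (2(n-1)) - g(b_11,b_22) + g(b_12,b_21)
     <= (sum_ij |b_ij|^2 + sum_ij g(b_ij,b_ji)) / 2,
>>
where b_ij = B'(E_i,E_j) and S = sum_i b_ii.  Its right-hand side is
sum_ij |b_ij + b_ji|^2 / 4.  The diagonal contributes sum_i |b_ii|^2, and the
entries (1,2) and (2,1) together |b_12 + b_21|^2 / 2 >= g(b_12,b_21)
([plane_symmetric_inequality]).  Cauchy-Schwarz for the n-1 vectors
b_11 + b_22, b_33, ..., b_nn gives |S|^2 / (n-1) <= sum_i |b_ii|^2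
+ 2 g(b_11,b_22) ([plane_diagonal_inequality]), which is Chen's lemma.

For these computations one needs that sums, multiples by smooth functions,
brackets and projections of smooth vector fields are again smooth.
Smoothness is defined by partial derivatives, and the components of a vector
field in a chart by a directional derivative of a change of coordinates; so
additivity in the vector rests on the theorem that continuous partial
derivatives make all directional derivatives linear in the direction
([is_derive_of_C1]).  The projection onto D is smooth because of the expansion
of a vector in the orthonormal frame ([smooth_projD]). *)

Set Implicit Arguments.
Unset Strict Implicit.
Unset Printing Implicit Defensive.

(** * Directional derivatives and functions of class C^k *)

Lemma is_derive_along_line (R : realType) (V : normedModType R) (f : V -> R)
    (e y : V) (c s : R) :
  derivable f ((s * c) *: e + y) e ->
  is_derive s 1 (fun r : R => f ((r * c) *: e + y))
    ('D_e f ((s * c) *: e + y) * c).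
Proof.
set z := (s * c) *: e + y => fz.
(* Recentre at [z], where [derivable1P] applies, and compose with an affine
   function of [r]. *)
pose psi (h : R) := f (h *: e + z).
have dpsi : is_derive ((0 : R) : R) 1 psi ('D_e f z).
  split; first exact: (derivable1P f z e).1.
  apply: (f_equal (fun F : R -> R => lim (F @ 0^'))); apply/funext => h /=.
  by rewrite /psi addr0 scale0r add0r [h%:A]mulr1.
have daff : is_derive (s : R) (1 : R) (fun r : R => r * c - s * c) c.
  have <- : c \*: (id : R -> R) - cst (s * c) = (fun r : R => r * c - s * c).
    by apply/funext => r; rewrite [r * c]mulrC.
  by apply: is_derive_eq; rewrite subr0 [LHS]mulr1.
rewrite -[X in is_derive _ _ X](_ : psi \o (fun r : R => r * c - s * c) = _).
  by apply: is_derive1_comp; rewrite subrr.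
apply/funext => r /=; rewrite /psi /z addrA -scalerDl subrK //.
Qed.

(** The difference quotient along [v + t *: e] is the one along [v] plus an
increment of [f] in the direction [e] alone, based at a moving point.  The mean
value theorem turns that increment into a value of the derivative along [e] at
a point tending to [x], which is why the latter must be continuous at [x]. *)
Lemma is_deriveD_direction (R : realType) (V : normedModType R) (f : V -> R)
    (x v e : V) (a t : R) :
  (\forall y \near x, derivable f y e) -> {for x, continuous ('D_e f)} ->
  is_derive x v f a -> is_derive x (v + t *: e) f (a + t * 'D_e f x).
Proof.
move=> fe ce [fv <-].
suff lim_ : (fun h : R => h^-1 *: ((f \o shift x) (h *: (v + t *: e)) - f x))
    @ 0^' --> 'D_v f x + t * 'D_e f x.
  by split; [apply/cvg_ex; eexists; exact: lim_ | exact: cvg_lim lim_].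
pose q1 (h : R) := h^-1 *: ((f \o shift x) (h *: v) - f x).
(* The factor [1] is the right end of the interval [0, 1] on which the mean
   value theorem is applied below. *)
pose q2 (h : R) :=
  h^-1 *: (f ((1 * (h * t)) *: e + (h *: v + x)) - f (h *: v + x)).
rewrite (_ : (fun _ => _) = q1 + q2); last first.
  apply/funext => h; rewrite /q1 /q2 /= -[RHS]scalerDr mul1r; congr (_ *: _).
  rewrite [h *: (_ + _)]scalerDr scalerA [RHS]addrC [RHS]addrA subrK.
  by rewrite -addrA addrCA.
apply: cvgD; first exact: fv.
apply/cvgrPdist_le => /= eps eps0; rewrite /q2.
have nn : \forall y \near x, derivable f y e /\ `|t * 'D_e f x - t * 'D_e f y| <= eps.
  near=> y; split; first by near: y.
  near: y.
  have : (fun y => t * 'D_e f y) @ x --> t * 'D_e f x.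
    by apply: cvgM; [exact: cvg_cst | exact: ce].
  by move=> /cvgrPdist_le /(_ _ eps0).
move: nn => /nbhs_ballP[d /= d0 dP].
near=> h.
have hn0 : h != 0 by near: h; exact: nbhs_dnbhs_neq.
(* The whole segment used by the mean value theorem stays in the ball. *)
have near_x s : s \in `[0, 1] ->
    ball x d ((s * (h * t)) *: e + (h *: v + x)).
  rewrite in_itv /= => /andP[s0 s1].
  rewrite -ball_normE /= addrA [_ + x]addrC opprD addrA subrr add0r normrN.
  apply: (@le_lt_trans _ _ (`|h| * (`|t| * `|e| + `|v|))).
    apply: le_trans (ler_normD _ _) _; rewrite mulrDr !normrZ lerD2r.
    rewrite (ger0_norm s0) !mulrA ler_wpM2r// ler_wpM2r// ler_piMl //.
  apply: (@le_lt_trans _ _ (`|h| * (`|t| * `|e| + `|v| + 1))).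
    by rewrite ler_wpM2l// lerDl.
  rewrite -ltr_pdivlMr ?ltr_wpDl ?addr_ge0 ?mulr_ge0 //.
  near: h; apply: dnbhs0_lt.
  by rewrite divr_gt0 ?ltr_wpDl ?addr_ge0 ?mulr_ge0.
have [||s s01] := @MVT_segment R (fun r => f ((r * (h * t)) *: e + (h *: v + x)))
   (fun r => 'D_e f ((r * (h * t)) *: e + (h *: v + x)) * (h * t)) 0 1 ler01.
- move=> s s01; apply: is_derive_along_line.
  by have [] := dP _ (near_x s (subset_itvW _ _ _ _ s01)).
- apply: derivable_within_continuous => s s01.
  have [] := dP _ (near_x s s01) => /is_derive_along_line []//.
rewrite mul0r scale0r add0r subr0 mulr1 => ->.
rewrite mulrCA scalerA mulVf // scale1r mulrC -mulrBl mulrC mulrBr.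
exact: (dP _ (near_x s s01)).2.
Unshelve. all: by end_near. Qed.

(** Obtained by adding the coordinate directions one at a time to the zero
vector. *)
Lemma is_derive_of_partials (R : realType) (m : nat) (f : 'rV[R]_m -> R)
    (x v : 'rV[R]_m) :
  (forall i, \forall y \near x, derivable f y (delta_mx 0 i)) ->
  (forall i, {for x, continuous ('D_(delta_mx 0 i) f)}) ->
  is_derive x v f (\sum_i v 0 i * 'D_(delta_mx 0 i) f x).
Proof.
move=> df cf; rewrite {1}[v]row_sum_delta.
elim/big_rec2: _ => [|i a w _ IH]; first exact: is_derive0.
by rewrite [_ *: _ + _]addrC [_ * _ + _]addrC; exact: is_deriveD_direction.
Qed.

Lemma is_derive_mx (R : realType) (V : normedModType R) (m n : nat)
    (F : V -> 'M[R]_(m, n)) (x v : V) (l : 'M[R]_(m, n)) :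
  (forall i j, is_derive x v (fun y => F y i j) (l i j)) -> is_derive x v F l.
Proof.
move=> Fl; have Fv : derivable F x v.
  by apply/derivable_mxP => i j; have [] := Fl i j.
split => //; rewrite derive_mx //; apply/matrixP => i j; rewrite mxE.
by have [_] := Fl i j.
Qed.

Lemma near_eq_continuous (T U : topologicalType) (f h : T -> U) (x : T) :
  (\forall y \near x, f y = h y) -> {for x, continuous f} ->
  {for x, continuous h}.
Proof.
move=> fh cf; rewrite /prop_for /continuous_at -(nbhs_singleton fh).
by apply: cvg_trans cf; exact: near_eq_cvg.
Qed.

(** Proved one component at a time, because the mean value theorem behind it
holds for real-valued functions only. *)
Lemma is_derive_of_C1 (R : realType) (m n : nat) (O : set 'rV[R]_m)
    (F : 'rV[R]_m -> 'rV[R]_n) (x v : 'rV[R]_m) :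
  open O -> Ck_on 1 O F -> O x ->
  is_derive x v F (\sum_i v 0 i *: 'D_(delta_mx 0 i) F x).
Proof.
move=> oO [_ F1] Ox; apply: is_derive_mx => k j; rewrite ord1 summxE.
have comp i y : O y -> is_derive y (delta_mx 0 i) (fun z => F z 0 j)
    ('D_(delta_mx 0 i) F y 0 j).
  move=> Oy; have Fy := (F1 i).1 y Oy.
  by split; [exact: (derivable_mxP _ _ _).1 | rewrite derive_mx // mxE].
have nO : \forall y \near x, O y by exact: open_nbhs_nbhs.
have -> : \sum_i (v 0 i *: 'D_(delta_mx 0 i) F x) 0 j =
    \sum_i v 0 i * 'D_(delta_mx 0 i) (fun z => F z 0 j) x.
  by apply: eq_bigr => i _; rewrite mxE; have [_ ->] := comp i x Ox.
apply: is_derive_of_partials => i.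
  by apply: filterS nO => y /(comp i) [].
apply: (near_eq_continuous (f := fun y => 'D_(delta_mx 0 i) F y 0 j)).
  by apply: filterS nO => y /(comp i) [].
apply: (@continuous_comp _ _ _ ('D_(delta_mx 0 i) F) (fun M => M 0 j)).
  exact: ((F1 i).2.1 x Ox).
exact: coord_continuous.
Qed.

Lemma Ck_on_ext (R : realType) (m : nat) (V : normedModType R) (k : nat)
    (O : set 'rV[R]_m) (f h : 'rV[R]_m -> V) :
  open O -> {in O, f =1 h} -> Ck_on k O f -> Ck_on k O h.
Proof.
move=> oO; elim: k f h => [|k IH] f h fh [cf df].
all: have nfh x : O x -> \forall y \near x, f y = h y.
1,3: by move=> Ox; apply: filterS (open_nbhs_nbhs (conj oO Ox)) => y Oy;
  apply: fh; rewrite inE.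
all: have ch x : O x -> {for x, continuous h}.
1,3: by move=> Ox; apply: near_eq_continuous (nfh x Ox) (cf x Ox).
  by [].
split=> // i; have [dfi Cfi] := df i; split=> [x Ox|].
  exact: near_eq_derivable (nfh x Ox) (dfi x Ox).
by apply: IH Cfi => x /[!inE] Ox; apply: near_eq_derive; exact: nfh.
Qed.

Lemma Ck_on_sub (R : realType) (m : nat) (V : normedModType R) (k : nat)
    (O O' : set 'rV[R]_m) (f : 'rV[R]_m -> V) :
  O' `<=` O -> Ck_on k O f -> Ck_on k O' f.
Proof.
move=> sO; elim: k f => [|k IH] f [cf df].
  by split=> // x /sO; exact: cf.
split=> [x /sO|i]; first exact: cf.
by have [dfi Cfi] := df i; split=> [x /sO|]; [exact: dfi | exact: IH].
Qed.

Lemma Ck_onW (R : realType) (m : nat) (V : normedModType R) (k : nat)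
    (O : set 'rV[R]_m) (f : 'rV[R]_m -> V) : Ck_on k.+1 O f -> Ck_on k O f.
Proof.
elim: k f => [|k IH] f [cf df]; first by [].
by split=> // i; have [dfi Cfi] := df i; split=> //; exact: IH.
Qed.

Lemma Ck_onD (R : realType) (m : nat) (V : normedModType R) (k : nat)
    (O : set 'rV[R]_m) (f h : 'rV[R]_m -> V) :
  open O -> Ck_on k O f -> Ck_on k O h -> Ck_on k O (f + h).
Proof.
move=> oO; elim: k f h => [|k IH] f h [cf df] [ch dh].
  by split=> // x Ox; apply: continuousD; [exact: cf | exact: ch].
split=> [x Ox|i]; first by apply: continuousD; [exact: cf | exact: ch].
have [dfi Cfi] := df i; have [dhi Chi] := dh i; split=> [x Ox|].
  by apply: derivableD; [exact: dfi | exact: dhi].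
apply: (Ck_on_ext (f := 'D_(delta_mx 0 i) f + 'D_(delta_mx 0 i) h)) => //.
  by move=> x /[!inE] Ox; rewrite deriveD //; [exact: dfi | exact: dhi].
exact: IH.
Qed.

(** Only the continuity of [f] along the line through [x] directed by [v] is
involved, and derivability along [v] provides it. *)
Lemma is_derive_scale (R : realType) (V W : normedModType R) (f : V -> R)
    (h : V -> W) (x v : V) :
  derivable f x v -> derivable h x v ->
  is_derive x v (fun y => f y *: h y) (f x *: 'D_v h x + 'D_v f x *: h x).
Proof.
move=> df dh.
suff lim_ : (fun r : R => r^-1 *: (((fun y => f y *: h y) \o shift x) (r *: v)
    - f x *: h x)) @ 0^' --> f x *: 'D_v h x + 'D_v f x *: h x.
  by split; [apply/cvg_ex; eexists; exact: lim_ | exact: cvg_lim lim_].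
pose q1 (r : R) := f (r *: v + x) *: (r^-1 *: ((h \o shift x) (r *: v) - h x)).
pose q2 (r : R) := (r^-1 *: ((f \o shift x) (r *: v) - f x)) *: h x.
rewrite (_ : (fun _ => _) = q1 + q2); last first.
  apply/funext => r; change (r^-1 *: (f (r *: v + x) *: h (r *: v + x) - f x *: h x)
    = f (r *: v + x) *: (r^-1 *: (h (r *: v + x) - h x))
    + (r^-1 * (f (r *: v + x) - f x)) *: h x).
  rewrite -scalerA [f _ *: (_ *: _)]scalerA [f _ * _]mulrC -scalerA -scalerDr.
  by congr (_ *: _); rewrite scalerBr scalerBl [RHS]addrA subrK.
apply: cvgD; last exact: cvgZr_tmp df.
apply: cvg_comp2 (@scale_continuous _ _ (_, _)) => /=; last exact: dh.
suff : {for 0, continuous (fun r : R => f (r *: v + x))}.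
  by move=> /continuous_withinNx; rewrite scale0r add0r.
exact/differentiable_continuous/derivable1_diffP/(derivable1P _ _ _).1.
Qed.

Lemma Ck_on_scale (R : realType) (m : nat) (V : normedModType R) (k : nat)
    (O : set 'rV[R]_m) (f : 'rV[R]_m -> R) (h : 'rV[R]_m -> V) :
  open O -> Ck_on k O f -> Ck_on k O h -> Ck_on k O (fun x => f x *: h x).
Proof.
move=> oO; elim: k f h => [|k IH] f h fk hk.
  have [[cf _] [ch _]] := (fk, hk).
  by split=> // x Ox; apply: continuousZ; [exact: cf | exact: ch].
have [[cf df] [ch dh]] := (fk, hk).
split=> [x Ox|i]; first by apply: continuousZ; [exact: cf | exact: ch].
have [dfi Cfi] := df i; have [dhi Chi] := dh i.
have dfh x : O x -> is_derive x (delta_mx 0 i) (fun y => f y *: h y)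
   (f x *: 'D_(delta_mx 0 i) h x + 'D_(delta_mx 0 i) f x *: h x).
  by move=> Ox; apply: is_derive_scale; [exact: dfi | exact: dhi].
split=> [x /dfh[]//|].
apply: (Ck_on_ext (f := (fun x => f x *: 'D_(delta_mx 0 i) h x) +
                        (fun x => 'D_(delta_mx 0 i) f x *: h x))) => //.
  by move=> x /[!inE] /dfh [_ ->].
by apply: Ck_onD => //; apply: IH => //; exact: Ck_onW.
Qed.

Lemma Ck_on_cst (R : realType) (m : nat) (V : normedModType R) (k : nat)
    (O : set 'rV[R]_m) (a : V) : Ck_on k O (cst a).
Proof.
elim: k a => [|k IH] a; (split; first by move=> x _; exact: cst_continuous) => //.
move=> i; split=> [x _|]; first exact: derivable_cst.
rewrite (_ : 'D_(delta_mx 0 i) (cst a) = cst 0); first exact: IH.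
by apply/funext => x; rewrite derive_cst.
Qed.

(** * Smooth vector fields *)

Section SmoothFields.
Variables (R : realType) (m : nat) (M : smooth_manifold R m).
Implicit Types (c : chart R m M) (W : set M) (X Y : vfield M) (p : M).

Lemma chart_at_atlas p : atlas (chart_at p).
Proof. by rewrite /chart_at; case: cid2. Qed.

Lemma chart_at_dom p : chart_dom (chart_at p) p.
Proof. by rewrite /chart_at; case: cid2. Qed.

Lemma chart_over_open c W : open W -> open (chart_over c W).
Proof.
move=> oW; rewrite openE => x [cx Wx].
apply: filterI; first by apply: open_nbhs_nbhs; split=> //; exact: chart_cod_open.
by apply: (chart_inv_continuous cx); exact: open_nbhs_nbhs.
Qed.

Lemma chart_over_pt p W : W p -> chart_over (chart_at p) W (chart_pt p).
Proof.
move=> Wp; split; first exact/chart_map_cod/chart_at_dom.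
by rewrite /= chart_mapK //; exact: chart_at_dom.
Qed.

(** Linear because changes of coordinates are of class C^1, so that
[is_derive_of_C1] applies. *)
Lemma tangent_coordP c p a (u v : 'rV[R]_m) : atlas c -> chart_dom c p ->
  tangent_coord c p (a *: u + v) =
  a *: tangent_coord c p u + tangent_coord c p v.
Proof.
move=> ac cp.
have D w := is_derive_of_C1 w (chart_over_open (c := chart_at p) (chart_dom_open c))
  (atlas_smooth (chart_at_atlas p) ac 1) (chart_over_pt cp).
rewrite /tangent_coord !(derive_val (is_derive := D _)) scaler_sumr -big_split /=.
by apply: eq_bigr => i _; rewrite !mxE scalerDl scalerA.
Qed.

Lemma tangent_coordD c p (u v : 'rV[R]_m) : atlas c -> chart_dom c p ->
  tangent_coord c p (u + v) = tangent_coord c p u + tangent_coord c p v.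
Proof. by move=> ac cp; rewrite -{1}[u]scale1r tangent_coordP // scale1r. Qed.

Lemma tangent_coordZ c p a (u : 'rV[R]_m) : atlas c -> chart_dom c p ->
  tangent_coord c p (a *: u) = a *: tangent_coord c p u.
Proof.
move=> ac cp; rewrite -[a *: u]addr0 (tangent_coordP _ _ _ ac cp).
by rewrite [X in _ + X]derive0 addr0.
Qed.

Lemma smooth_vfield_ext W X Y : open W -> {in W, X =1 Y} ->
  smooth_vfield_on W X -> smooth_vfield_on W Y.
Proof.
move=> oW XY sX c ac k; apply: Ck_on_ext (sX c ac k); first exact: chart_over_open.
by move=> x /[!inE] -[_ Wx]; rewrite /vfield_in_chart XY ?inE.
Qed.

Lemma smooth_vfieldS W W' X : W' `<=` W ->
  smooth_vfield_on W X -> smooth_vfield_on W' X.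
Proof.
move=> sW sX c ac k; apply: Ck_on_sub (sX c ac k).
by move=> x [cx Wx]; split => //; exact: sW.
Qed.

Lemma smooth_vfieldD W X Y : open W ->
  smooth_vfield_on W X -> smooth_vfield_on W Y ->
  smooth_vfield_on W (fun q => X q + Y q).
Proof.
move=> oW sX sY c ac k.
apply: (Ck_on_ext (f := vfield_in_chart c X + vfield_in_chart c Y)).
- exact: chart_over_open.
- move=> x /[!inE] -[cx _]; rewrite /vfield_in_chart tangent_coordD //.
  exact: chart_inv_dom.
by apply: Ck_onD; [exact: chart_over_open | exact: sX | exact: sY].
Qed.

Lemma smooth_vfieldZ W (f : M -> R) X : open W ->
  smooth_fun_on W f -> smooth_vfield_on W X ->
  smooth_vfield_on W (fun q => f q *: X q).
Proof.
move=> oW sf sX c ac k.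
apply: (Ck_on_ext (f := fun x => f (chart_inv c x) *: vfield_in_chart c X x)).
- exact: chart_over_open.
- move=> x /[!inE] -[cx _]; rewrite /vfield_in_chart tangent_coordZ //.
  exact: chart_inv_dom.
by apply: Ck_on_scale; [exact: chart_over_open | exact: sf | exact: sX].
Qed.

Lemma smooth_fun_cst W (a : R) : smooth_fun_on W (fun=> a).
Proof. by move=> c ac k; exact: Ck_on_cst. Qed.

Lemma smooth_vfield0 W : smooth_vfield_on W (fun=> 0).
Proof.
move=> c ac k; rewrite (_ : vfield_in_chart c _ = cst 0); first exact: Ck_on_cst.
by apply/funext => x; rewrite /vfield_in_chart /tangent_coord derive0.
Qed.

Lemma smooth_vfieldN W X : open W ->
  smooth_vfield_on W X -> smooth_vfield_on W (fun q => - X q).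
Proof.
move=> oW sX; rewrite (_ : (fun _ => _) = fun q => -1 *: X q).
  by apply: smooth_vfieldZ => //; exact: smooth_fun_cst.
by apply/funext => q; rewrite scaleN1r.
Qed.

Lemma smooth_vfieldB W X Y : open W ->
  smooth_vfield_on W X -> smooth_vfield_on W Y ->
  smooth_vfield_on W (fun q => X q - Y q).
Proof.
by move=> oW sX sY; exact: (smooth_vfieldD oW sX (smooth_vfieldN oW sY)).
Qed.

Lemma smooth_vfield_sum W n (F : 'I_n -> vfield M) : open W ->
  (forall i, smooth_vfield_on W (F i)) ->
  smooth_vfield_on W (fun q => \sum_i F i q).
Proof.
move=> oW sF; elim: index_enum => [|i r IH].
  rewrite (_ : (fun _ => _) = fun=> 0); first exact: smooth_vfield0.
  by apply/funext => q; rewrite big_nil.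
rewrite (_ : (fun _ => _) = fun q => F i q + \sum_(j <- r) F j q).
  exact: (smooth_vfieldD oW (sF i) IH).
by apply/funext => q; rewrite big_cons.
Qed.

(** Only the germ of [f] matters, so vanishing on the open set [W] suffices: this
serves for functions such as g(V^perp, E_i), which vanish where the frame lies
in D. *)
Lemma vderive_eq0 W X (f : M -> R) p : open W -> W p ->
  (forall q, W q -> f q = 0) -> vderive X f p = 0.
Proof.
move=> oW Wp f0; rewrite /vderive (near_eq_derive (g := cst 0)) ?derive_cst //.
have := open_nbhs_nbhs (conj (chart_over_open (c := chart_at p) oW) (chart_over_pt Wp)).
by apply: filterS => x [_ /= /f0].
Qed.

End SmoothFields.

(** * Metric and orthogonal splitting along a distribution *)

Section InnerProduct.
Variables (R : realType) (m : nat) (M : smooth_manifold R m).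
Variables (g : riemannian_metric M) (p : M).
Implicit Types u v w : 'rV[R]_m.

Lemma innerC u v : inner g p u v = inner g p v u.
Proof.
rewrite /inner -[LHS](mxE trmx_key (fun i j => (u *m g p *m v^T) j i)).
by rewrite -/(trmx _) !trmx_mul trmxK gram_sym mulmxA.
Qed.

Lemma innerDl u v w : inner g p (u + v) w = inner g p u w + inner g p v w.
Proof. by rewrite /inner !mulmxDl mxE. Qed.

Lemma innerZl a u w : inner g p (a *: u) w = a * inner g p u w.
Proof. by rewrite /inner -!scalemxAl mxE. Qed.

Lemma innerNl u w : inner g p (- u) w = - inner g p u w.
Proof. by rewrite -scaleN1r innerZl mulN1r. Qed.

Lemma innerDr u v w : inner g p w (u + v) = inner g p w u + inner g p w v.
Proof. by rewrite innerC innerDl !(innerC _ w). Qed.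

Lemma innerZr a u w : inner g p w (a *: u) = a * inner g p w u.
Proof. by rewrite innerC innerZl (innerC u). Qed.

Lemma innerNr u w : inner g p w (- u) = - inner g p w u.
Proof. by rewrite innerC innerNl (innerC u). Qed.

Definition innerE :=
  (innerDl, innerDr, innerNl, innerNr, innerZl, innerZr).

Lemma inner0l w : inner g p 0 w = 0.
Proof. by rewrite -(scale0r 0) innerZl mul0r. Qed.

Lemma inner_suml (I : Type) (r : seq I) (F : I -> 'rV[R]_m) w :
  inner g p (\sum_(i <- r) F i) w = \sum_(i <- r) inner g p (F i) w.
Proof.
elim/big_rec2: _ => [|i a v _ <-]; first exact: inner0l.
exact: innerDl.
Qed.

Lemma inner_ge0 v : 0 <= inner g p v v.
Proof.
have [->|v0] := eqVneq v 0; first by rewrite inner0l.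
exact/ltW/gram_pos.
Qed.

Lemma inner_eq0 v : inner g p v v = 0 -> v = 0.
Proof.
by move=> v0; apply/eqP/negPn/negP => /(gram_pos g p); rewrite v0 ltxx.
Qed.

End InnerProduct.

Section OrthogonalSplitting.
Variables (R : realType) (m n : nat) (M : smooth_manifold R m).
Variables (g : riemannian_metric M) (D : tangent_subbundle M n).
Implicit Types (X Y : vfield M) (p : M).

Lemma inner_orthogonal_fibre p u v :
  (u <= orthogonal_fibre g D p)%MS -> (v <= D p)%MS -> inner g p u v = 0.
Proof.
move=> /sub_kermxP u0 /submxP[a ->].
by rewrite /inner trmx_mul -!mulmxA (mulmxA (g p)) (mulmxA u) u0 mul0mx mxE.
Qed.

Lemma cap_orthogonal_fibre p : (D p :&: orthogonal_fibre g D p = 0)%MS.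
Proof.
apply/eqP; rewrite -submx0; apply/rV_subP => v; rewrite sub_capmx.
case/andP => vD vO; rewrite submx0; apply/eqP/(inner_eq0 (g := g) (p := p)).
exact: inner_orthogonal_fibre vO vD.
Qed.

(** A dimension count: the normal fibre is the kernel of a matrix of rank at
most [n], and it meets the fibre of D trivially. *)
Lemma add_orthogonal_fibre p : (1%:M <= D p + orthogonal_fibre g D p)%MS.
Proof.
rewrite sub1mx -col_leq_rank.
have := mxrank_sum_cap (D p) (orthogonal_fibre g D p).
rewrite cap_orthogonal_fibre mxrank0 addn0 => ->.
rewrite mxrank_ker -leq_subLR leq_sub2l //.
by rewrite -[X in (_ <= X)%N]mxrank_tr mxrankM_maxr.
Qed.

Lemma projD_sub X p : (projD g D X p <= D p)%MS.
Proof. exact: proj_mx_sub. Qed.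

Lemma inner_projDperp X p v : (v <= D p)%MS -> inner g p (projDperp g D X p) v = 0.
Proof. by apply: inner_orthogonal_fibre; exact: proj_mx_sub. Qed.

Lemma projD_add X p : projD g D X p + projDperp g D X p = X p.
Proof.
apply: add_proj_mx; first exact: cap_orthogonal_fibre.
exact: submx_trans (submx1 _) (add_orthogonal_fibre p).
Qed.

Lemma projDperpE X : projDperp g D X = fun q => X q - projD g D X q.
Proof. by apply/funext => q; rewrite -(projD_add X q) addrC addKr. Qed.

Lemma inner_projD X p v : (v <= D p)%MS ->
  inner g p (projD g D X p) v = inner g p (X p) v.
Proof.
by move=> vD; rewrite -(projD_add X p) innerDl inner_projDperp // addr0.
Qed.

(** The Gram matrix of the frame is the identity, so its [n] vectors are
independent and span the fibre, which has rank [n]; the coefficients are then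
read off by pairing with the frame. *)
Lemma orthonormal_expansion W (E : 'I_n -> vfield M) p v :
  orthonormal_frame_on g D W E -> W p -> (v <= D p)%MS ->
  v = \sum_i inner g p v (E i p) *: E i p.
Proof.
move=> [secE onE] Wp.
pose A := \matrix_i E i p; have AD : (A <= D p)%MS.
  by apply/row_subP => i; rewrite rowK; exact: (secE i).2.
have A1 : A *m g p *m A^T = 1%:M.
  apply/matrixP => i j; rewrite [RHS]mxE -(onE p Wp) /metric_of /inner.
  rewrite -[E i p](rowK (fun i => E i p)) -[E j p](rowK (fun i => E i p)).
  rewrite -/A tr_row -row_mul -row_mul.
  by rewrite !mxE; apply: eq_bigr => k _; rewrite !mxE.
have rA : \rank A = n.
  apply/eqP/row_freeP; exists (g p *m A^T); by rewrite mulmxA.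
have /eqmxP/eqmx_sym DA : (A == D p)%MS.
  by rewrite -(geq_leqif (mxrank_leqif_eq AD)) fibre_rank rA.
rewrite DA => /submxP[a ->].
rewrite {1}mulmx_sum_row; apply: eq_bigr => i _; rewrite rowK; congr (_ *: _).
have -> : inner g p (a *m A) (E i p) = (a *m (A *m g p *m A^T)) 0 i.
  rewrite /inner -[E i p](rowK (fun i => E i p)) -/A tr_row !mulmxA.
  by rewrite !mxE; apply: eq_bigr => k _; rewrite !mxE.
by rewrite A1 mulmx1.
Qed.

(** The expansion pi^D X = sum_i g(X, E_i) E_i displays the projection through
smooth functions. *)
Lemma smooth_projD W (E : 'I_n -> vfield M) X : open W ->
  orthonormal_frame_on g D W E -> smooth_vfield_on W X ->
  smooth_vfield_on W (projD g D X).
Proof.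
move=> oW fE sX.
have sE i := smooth_vfieldZ oW (gram_smooth g oW sX (fE.1 i).1) (fE.1 i).1.
apply: smooth_vfield_ext oW _ (smooth_vfield_sum oW sE).
move=> q /[!inE] Wq; rewrite [RHS](orthonormal_expansion fE Wq) ?projD_sub //.
by apply: eq_bigr => i _; rewrite inner_projD //; exact: (fE.1 i).2.
Qed.

Lemma smooth_projDperp W (E : 'I_n -> vfield M) X : open W ->
  orthonormal_frame_on g D W E -> smooth_vfield_on W X ->
  smooth_vfield_on W (projDperp g D X).
Proof.
move=> oW fE sX; rewrite projDperpE.
exact: (smooth_vfieldB oW sX (smooth_projD oW fE sX)).
Qed.

End OrthogonalSplitting.

(** * The inequality for a family of vectors *)

Section PlaneInequality.
Variables (R : realType) (m : nat) (M : smooth_manifold R m).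
Variables (g : riemannian_metric M) (p : M) (n : nat).
Variables (b : 'I_n -> 'I_n -> 'rV[R]_m) (i1 i2 : 'I_n).
Local Notation "<< u , v >>" := (inner g p u v).

(** Chen's lemma, that is, Cauchy-Schwarz for the [n - 1] vectors
[b i1 i1 + b i2 i2] and [b i i], [i] different from [i1] and [i2], whose sum is
[S]. *)
Lemma plane_diagonal_inequality (S := \sum_i b i i) : (2 < n)%N -> i2 != i1 ->
  <<S, S>> / (n%:R - 1) <=
  \sum_i <<b i i, b i i>> + 2 * <<b i1 i1, b i2 i2>>.
Proof.
move=> n2 i12.
have N1 : 0 < n%:R - 1 :> R by rewrite subr_gt0 ltr1n (ltn_trans _ n2).
(* Summing the squared distances to the mean [t] of the [n - 1] vectors. *)
have [t tE] : exists t, t = (n%:R - 1)^-1 *: S by eexists.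
have E : \sum_i <<b i i - t, b i i - t>> =
    \sum_i <<b i i, b i i>> - 2 * <<S, t>> + n%:R * <<t, t>>.
  rewrite /S inner_suml mulr_sumr -sumrB.
  have -> : n%:R * <<t, t>> = \sum_(i < n) <<t, t>>.
    by rewrite sumr_const card_ord mulr_natl.
  rewrite -big_split /=.
  by apply: eq_bigr => i _; rewrite !innerE (innerC _ _ t); ring.
(* The first two vectors enter only through their sum, in [G] below. *)
have F : 0 <= \sum_(i | (i != i1) && (i != i2)) <<b i i - t, b i i - t>>.
  by apply: sumr_ge0 => i _; exact: inner_ge0.
move: E; rewrite (bigD1 i1) //= (bigD1 i2) //= => E.
have G := inner_ge0 g p (b i1 i1 + b i2 i2 - t).
have St : <<S, t>> = <<S, S>> / (n%:R - 1) by rewrite tE innerZr mulrC.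
have tt : (n%:R - 1) * <<t, t>> = <<S, S>> / (n%:R - 1).
  by rewrite tE innerZl innerZr mulVKf ?gt_eqF // mulrC.
move: E F G St tt; rewrite !innerE.
rewrite !(innerC _ _ t) (innerC _ _ (b i2 i2) (b i1 i1)).
lra.
Qed.

(** The right-hand side is a quarter of the sum of all |b_ij + b_ji|^2.  Keep
the diagonal and the two entries indexed by [i1] and [i2]:
2 |u + v|^2 / 4 >= <u, v> for all vectors u and v. *)
Lemma plane_symmetric_inequality : i2 != i1 ->
  \sum_i <<b i i, b i i>> + <<b i1 i2, b i2 i1>> <=
  (\sum_i \sum_j <<b i j, b i j>> + \sum_i \sum_j <<b i j, b j i>>) / 2.
Proof.
move=> i12.
have -> : (\sum_i \sum_j <<b i j, b i j>> + \sum_i \sum_j <<b i j, b j i>>) / 2 =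
   \sum_i \sum_j <<b i j + b j i, b i j + b j i>> / 4.
  transitivity ((\sum_i \sum_j <<b i j, b i j>> + \sum_j \sum_i <<b i j, b i j>>
     + 2 * \sum_i \sum_j <<b i j, b j i>>) / 4).
    by rewrite [X in _ = (_ + X + _) / _]exchange_big /=; lra.
  rewrite mulr_sumr -!big_split mulr_suml; apply: eq_bigr => i _ /=.
  rewrite mulr_sumr -!big_split mulr_suml; apply: eq_bigr => j _ /=.
  by rewrite !innerE (innerC _ _ (b j i) (b i j)); lra.
have pos i j : 0 <= <<b i j + b j i, b i j + b j i>> / 4.
  by rewrite divr_ge0 ?inner_ge0.
have row i j : j != i -> <<b i i, b i i>> + <<b i j + b j i, b i j + b j i>> / 4
   <= \sum_j <<b i j + b j i, b i j + b j i>> / 4.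
  move=> ji; rewrite (bigD1 i) //= (bigD1 j) //=.
  have : 0 <= \sum_(k | (k != i) && (k != j)) <<b i k + b k i, b i k + b k i>> / 4.
    by apply: sumr_ge0.
  by rewrite !innerE; lra.
have row0 i : <<b i i, b i i>> <= \sum_j <<b i j + b j i, b i j + b j i>> / 4.
  rewrite (bigD1 i) //=.
  have : 0 <= \sum_(k | k != i) <<b i k + b k i, b i k + b k i>> / 4.
    by apply: sumr_ge0.
  by rewrite !innerE; lra.
rewrite (bigD1 i1) //= (bigD1 i2) //= [leRHS](bigD1 i1) //= [X in _ <= _ + X](bigD1 i2) //=.
have := row i1 i2 i12; have := row i2 i1; rewrite eq_sym => /(_ i12).
have : \sum_(i | (i != i1) && (i != i2)) <<b i i, b i i>> <=
  \sum_(i | (i != i1) && (i != i2)) \sum_j <<b i j + b j i, b i j + b j i>> / 4.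
  by apply: ler_sum => i _; exact: row0.
have := inner_ge0 g p (b i1 i2); have := inner_ge0 g p (b i2 i1).
rewrite !(innerDl, innerDr) (innerC _ _ (b i2 i1) (b i1 i2)).
lra.
Qed.

End PlaneInequality.

(** * Connections and the semi-symmetric modification *)

Section Connections.
Variables (R : realType) (m : nat) (M : smooth_manifold R m).
Variables (nabla : vfield M -> vfield M -> vfield M) (W : set M).
Hypotheses (oW : open W) (conn : affine_connection nabla).
Implicit Types (X Y Z V : vfield M) (p : M).

Lemma conn_subr X Y Y' p : W p -> smooth_vfield_on W X ->
  smooth_vfield_on W Y -> smooth_vfield_on W Y' ->
  nabla X (fun q => Y q - Y' q) p = nabla X Y p - nabla X Y' p.
Proof.
move=> Wp sX sY sY'.
have /= := conn_addr conn oW sX (smooth_vfieldB oW sY sY') sY' Wp.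
under eq_fun do rewrite subrK.
by move=> ->; rewrite addrK.
Qed.

(** Constant sectional curvature gives R(E_i,E_j,E_j,E_i) directly; this
antisymmetry turns R(E_j,E_i,E_i,E_j) into R(E_i,E_j,E_i,E_j), the other
curvature component in the definition of [planeK]. *)
Lemma curvature_antisym X Y Z p : W p -> smooth_vfield_on W (lie_bracket X Y) ->
  smooth_vfield_on W Z -> curvature nabla X Y Z p = - curvature nabla Y X Z p.
Proof.
move=> Wp sL sZ; rewrite /curvature.
have -> : lie_bracket Y X = fun q => -1 *: lie_bracket X Y q.
  by apply/funext => q; rewrite scaleN1r opprB.
rewrite (conn_scalel conn oW (smooth_fun_cst W (-1)) sL sZ Wp) scaleN1r opprK.
by rewrite opprD opprB.
Qed.

(** Torsion-freeness expresses the bracket through the connection, which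
preserves smoothness; this spares a computation in coordinates. *)
Lemma smooth_lie_bracket X Y : torsion_free nabla ->
  smooth_vfield_on W X -> smooth_vfield_on W Y ->
  smooth_vfield_on W (lie_bracket X Y).
Proof.
move=> tf sX sY.
apply: smooth_vfield_ext oW _ (smooth_vfieldB oW
  (conn_smooth conn oW sX sY) (conn_smooth conn oW sY sX)).
by move=> q /[!inE]; exact: tf.
Qed.

End Connections.

(** Stated for an arbitrary [nab], because [semi_symmetric] is itself a sum,
which an expansion by [innerDl] would expand as well. *)
Lemma inner_curvature (R : realType) (m : nat) (M : smooth_manifold R m)
    (g : riemannian_metric M) nab (X Y Z : vfield M) p w :
  inner g p (curvature nab X Y Z p) w = inner g p (nab X (nab Y Z) p) w
  - inner g p (nab Y (nab X Z) p) w - inner g p (nab (lie_bracket X Y) Z p) w.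
Proof. by rewrite /curvature !(innerDl, innerNl). Qed.

Lemma inner_curvatureD (R : realType) (m n : nat) (M : smooth_manifold R m)
    (g : riemannian_metric M) (D : tangent_subbundle M n) nab
    (X Y Z : vfield M) p w (L := lie_bracket X Y)
    (nabD := induced_connection g D nab) :
  inner g p (curvatureD g D nab X Y Z p) w = inner g p (nabD X (nabD Y Z) p) w
  - inner g p (nabD Y (nabD X Z) p) w - inner g p (nabD (projD g D L) Z p) w
  - inner g p (projD g D (lie_bracket (projDperp g D L) Z) p) w.
Proof. by rewrite /curvatureD !(innerDl, innerNl). Qed.

Section SemiSymmetric.
Variables (R : realType) (m : nat) (M : smooth_manifold R m).
Variables (g : riemannian_metric M).
Variables (nabla : vfield M -> vfield M -> vfield M) (U : vfield M).
Variables (W : set M) (p : M).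
Hypotheses (oW : open W) (Wp : W p) (hLC : levi_civita g nabla).
Hypothesis sU : smooth_vfield_on W U.
Implicit Types X Y Z V : vfield M.

Local Notation tnabla := (semi_symmetric g nabla U).
Local Notation "<< u , v >>" := (inner g p u v).

Let conn : affine_connection nabla. Proof. by case: hLC. Qed.
Let tf : torsion_free nabla. Proof. by case: hLC. Qed.
Let mc : metric_compatible g nabla. Proof. by case: hLC. Qed.

Lemma smooth_semi_symmetric X Y :
  smooth_vfield_on W X -> smooth_vfield_on W Y ->
  smooth_vfield_on W (tnabla X Y).
Proof.
move=> sX sY; apply: (smooth_vfieldB oW).
  apply: (smooth_vfieldD oW); first exact: (conn_smooth conn oW sX sY).
    exact: (smooth_vfieldZ oW (gram_smooth g oW sU sY) sX).
exact: (smooth_vfieldZ oW (gram_smooth g oW sX sY) sU).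
Qed.

(** The two correction terms omega(Y) X and - g(X,Y) U cancel after
symmetrisation in [Y] and [Z], so the modified connection is again metric. *)
Lemma semi_symmetric_metric X Y Z : smooth_vfield_on W X ->
  smooth_vfield_on W Y -> smooth_vfield_on W Z ->
  vderive X (metric_of g Y Z) p =
  <<tnabla X Y p, Z p>> + <<Y p, tnabla X Z p>>.
Proof.
move=> sX sY sZ; rewrite (mc oW sX sY sZ Wp) /semi_symmetric /oneform /metric_of.
by rewrite !innerE (innerC _ _ (Y p) (X p)) (innerC _ _ (Y p) (U p)); ring.
Qed.

Lemma semi_symmetric_subr X Y Y' : smooth_vfield_on W X ->
  smooth_vfield_on W Y -> smooth_vfield_on W Y' ->
  tnabla X (fun q => Y q - Y' q) p = tnabla X Y p - tnabla X Y' p.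
Proof.
move=> sX sY sY'; rewrite /semi_symmetric /oneform /metric_of.
rewrite (conn_subr oW conn Wp sX sY sY') !innerE !scalerBl.
by apply/rowP => i; rewrite !mxE; ring.
Qed.

(** Metric compatibility turns the covariant derivative of omega = g(U, .) into
that of [U], which is the form in which it occurs in the curvature. *)
Lemma alphaE X Y : smooth_vfield_on W X -> smooth_vfield_on W Y ->
  alpha g nabla U X Y p = <<nabla X U p, Y p>>
  - <<U p, X p>> * <<U p, Y p>> + <<X p, Y p>> * <<U p, U p>> / 2.
Proof.
move=> sX sY; rewrite /alpha /nabla_oneform /oneform (mc oW sX sU sY Wp).
by rewrite /metric_of addrK.
Qed.

(** Yano's formula.  The derivatives of the coefficients g(U,Z) and g(Y,Z) in
N_Y Z are removed by metric compatibility, after which the identity is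
polynomial in inner products at [p]. *)
Lemma curvature_semi_symmetric X Y Z V :
  smooth_vfield_on W X -> smooth_vfield_on W Y -> smooth_vfield_on W Z ->
  smooth_vfield_on W V ->
  <<curvature tnabla X Y Z p, V p>> = <<curvature nabla X Y Z p, V p>>
  - alpha g nabla U Y Z p * <<X p, V p>> + alpha g nabla U X Z p * <<Y p, V p>>
  - <<Y p, Z p>> * alpha g nabla U X V p + <<X p, Z p>> * alpha g nabla U Y V p.
Proof.
move=> sX sY sZ sV.
have key A B : smooth_vfield_on W A -> smooth_vfield_on W B ->
  nabla A (tnabla B Z) p = nabla A (nabla B Z) p
   + (vderive A (metric_of g U Z) p *: B p + <<U p, Z p>> *: nabla A B p)
   - (vderive A (metric_of g B Z) p *: U p + <<B p, Z p>> *: nabla A U p).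
  move=> sA sB.
  have sN : smooth_vfield_on W (nabla B Z) := conn_smooth conn oW sB sZ.
  have sf : smooth_fun_on W (metric_of g U Z) := gram_smooth g oW sU sZ.
  have sh : smooth_fun_on W (metric_of g B Z) := gram_smooth g oW sB sZ.
  have sfB := smooth_vfieldZ oW sf sB; have shU := smooth_vfieldZ oW sh sU.
  rewrite (conn_subr oW conn Wp sA (smooth_vfieldD oW sN sfB) shU).
  rewrite (conn_addr conn oW sA sN sfB Wp) (conn_leibniz conn oW sf sA sB Wp).
  by rewrite (conn_leibniz conn oW sh sA sU Wp).
have step A B : smooth_vfield_on W A -> smooth_vfield_on W B ->
  <<tnabla A (tnabla B Z) p, V p>> = <<nabla A (nabla B Z) p, V p>>
  + (<<nabla A U p, Z p>> + <<U p, nabla A Z p>>) * <<B p, V p>>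
  + <<U p, Z p>> * <<nabla A B p, V p>>
  - (<<nabla A B p, Z p>> + <<B p, nabla A Z p>>) * <<U p, V p>>
  - <<B p, Z p>> * <<nabla A U p, V p>>
  + (<<U p, nabla B Z p>> + <<U p, Z p>> * <<U p, B p>>
     - <<B p, Z p>> * <<U p, U p>>) * <<A p, V p>>
  - (<<A p, nabla B Z p>> + <<U p, Z p>> * <<A p, B p>>
     - <<B p, Z p>> * <<U p, A p>>) * <<U p, V p>>.
  move=> sA sB; rewrite {1}/semi_symmetric (key A B sA sB).
  rewrite (mc oW sA sU sZ Wp) (mc oW sA sB sZ Wp).
  rewrite /oneform /metric_of /semi_symmetric /oneform /metric_of.
  rewrite !innerE (innerC g p (A p) (U p)); ring.
rewrite (alphaE sY sZ) (alphaE sX sZ) (alphaE sX sV) (alphaE sY sV).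
rewrite !inner_curvature (step X Y sX sY) (step Y X sY sX).
rewrite /semi_symmetric /oneform /metric_of -(tf oW sX sY Wp) !innerE.
rewrite (innerC g p (Y p) (X p)).
by field.
Qed.

End SemiSymmetric.

(** * The Gauss equation of a distribution *)

Section GaussEquation.
Variables (R : realType) (m n : nat) (M : smooth_manifold R m).
Variables (g : riemannian_metric M) (D : tangent_subbundle M n).
Variables (nabla : vfield M -> vfield M -> vfield M) (U : vfield M).
Variables (W : set M) (p : M) (E : 'I_n -> vfield M).
Hypotheses (oW : open W) (Wp : W p) (hLC : levi_civita g nabla).
Hypotheses (sU : smooth_vfield_on W U) (fE : orthonormal_frame_on g D W E).
Implicit Types X Y Z V : vfield M.

Local Notation tnabla := (semi_symmetric g nabla U).
Local Notation "<< u , v >>" := (inner g p u v).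

Let conn : affine_connection nabla. Proof. by case: hLC. Qed.
Let tf : torsion_free nabla. Proof. by case: hLC. Qed.
Let mc : metric_compatible g nabla. Proof. by case: hLC. Qed.

(** The Weingarten relation: differentiate g(pi^perp Z, V) = 0 along [X]. *)
Lemma inner_conn_projDperp X Z V :
  smooth_vfield_on W X -> smooth_vfield_on W Z -> section_on D W V ->
  <<tnabla X (projDperp g D Z) p, V p>> =
  - <<projDperp g D Z p, second_form g D tnabla X V p>>.
Proof.
move=> sX sZ [sV VD].
have sP := smooth_projDperp oW fE sZ.
have /eqP := semi_symmetric_metric U oW Wp hLC sX sP sV.
rewrite (vderive_eq0 X oW Wp); last first.
  by move=> q Wq; apply: inner_projDperp; exact: VD.
rewrite eq_sym addr_eq0 => /eqP ->; congr (- _).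
rewrite -[in LHS](projD_add g D (tnabla X V) p) innerDr inner_projDperp ?add0r //.
exact: projD_sub.
Qed.

Lemma inner_induced_induced X Y Z V : smooth_vfield_on W X ->
  smooth_vfield_on W Y -> smooth_vfield_on W Z -> section_on D W V ->
  <<induced_connection g D tnabla X (induced_connection g D tnabla Y Z) p, V p>>
  = <<tnabla X (tnabla Y Z) p, V p>>
  + <<second_form g D tnabla Y Z p, second_form g D tnabla X V p>>.
Proof.
move=> sX sY sZ [sV VD].
have sYZ := smooth_semi_symmetric oW hLC sU sY sZ.
have sP := smooth_projDperp oW fE sYZ.
rewrite inner_projD; last exact: VD.
have -> : induced_connection g D tnabla Y Z =
    fun q => tnabla Y Z q - projDperp g D (tnabla Y Z) q.
  by apply/funext => q; rewrite -[tnabla Y Z q in RHS](projD_add g D) addrK.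
rewrite (semi_symmetric_subr U oW Wp hLC sX sYZ sP) innerDl innerNl.
by rewrite (inner_conn_projDperp sX sYZ (conj sV VD)) opprK.
Qed.

(** Beyond the Weingarten terms, the bracket L = [X,Y] is split into its tangent
and normal parts L^D and L^perp.  The part N_{L^perp} Z missing from the induced
connection has the same D-component as nabla_{L^perp} Z, and the D-component of
[L^perp,Z] = nabla_{L^perp} Z - nabla_Z L^perp cancels it up to nabla_Z L^perp,
whose pairing with [V] is - g(L^perp, nabla_Z V) = - g(L, B(Z,V)). *)
Lemma gauss_equation X Y Z V :
  section_on D W X -> section_on D W Y -> section_on D W Z ->
  section_on D W V ->
  curvatureD4 g D tnabla X Y Z V p = <<curvature tnabla X Y Z p, V p>>
  + <<second_form g D tnabla Y Z p, second_form g D tnabla X V p>>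
  - <<second_form g D tnabla X Z p, second_form g D tnabla Y V p>>
  - <<second_form g D nabla Z V p, lie_bracket X Y p>>.
Proof.
move=> [sX XD] [sY YD] [sZ ZD] [sV VD].
have sL := smooth_lie_bracket oW conn tf sX sY.
have sL1 := smooth_projD oW fE sL; have sL2 := smooth_projDperp oW fE sL.
rewrite /curvatureD4 /metric_of inner_curvatureD inner_curvature.
rewrite [X in X - _ - _ - _ = _](inner_induced_induced sX sY sZ (conj sV VD)).
rewrite [X in _ - X - _ - _ = _](inner_induced_induced sY sX sZ (conj sV VD)).
have VDp := VD p Wp; have ZDp := ZD p Wp.
rewrite [<<induced_connection _ _ _ _ _ _, _>>]inner_projD //.
rewrite [<<projD g D (lie_bracket _ Z) p, _>>]inner_projD //.
move: sL sL1 sL2; move: (lie_bracket X Y) => L sL sL1 sL2.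
have LE : nabla L Z p = nabla (projD g D L) Z p + nabla (projDperp g D L) Z p.
  rewrite -(conn_addl conn oW sL1 sL2 sZ Wp); congr (nabla _ Z p).
  by apply/funext => q; rewrite projD_add.
have mcZ := mc oW sZ sL2 sV Wp.
rewrite (vderive_eq0 Z oW Wp) in mcZ; last first.
  by move=> q Wq; apply: inner_projDperp; exact: VD.
have LB : <<second_form g D nabla Z V p, L p>> =
    <<projDperp g D L p, nabla Z V p>>.
  have N0 := inner_projDperp g (nabla Z V) (projD_sub g D L p).
  have L0 := inner_projDperp g L (projD_sub g D (nabla Z V) p).
  rewrite -(projD_add g D L p) innerDr N0 add0r.
  by rewrite -[nabla Z V p](projD_add g D) [RHS]innerDr L0 add0r innerC.
have zperp : <<projDperp g D L p, Z p>> = 0 by exact: inner_projDperp.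
have vperp : <<projDperp g D L p, V p>> = 0 by exact: inner_projDperp.
have Lz : <<L p, Z p>> = <<projD g D L p, Z p>>.
  by rewrite -[in LHS](projD_add g D L p) innerDl zperp addr0.
have Lv : <<L p, V p>> = <<projD g D L p, V p>>.
  by rewrite -[in LHS](projD_add g D L p) innerDl vperp addr0.
have -> : <<tnabla L Z p, V p>> = <<tnabla (projD g D L) Z p, V p>>
    + <<nabla (projDperp g D L) Z p, V p>>.
  rewrite /semi_symmetric /oneform /metric_of LE !innerE Lz Lv; ring.
rewrite LB -(tf oW sL2 sZ Wp) innerDl innerNl.
have -> : <<nabla Z (projDperp g D L) p, V p>> =
    - <<projDperp g D L p, nabla Z V p>>.
  by apply/eqP; rewrite -addr_eq0; apply/eqP; rewrite -mcZ.
rewrite /metric_of.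
(* A linear identity between inner products remains. *)
repeat match goal with
  |- context [inner ?h ?q ?u ?v] => generalize (inner h q u v); intro
end.
ring.
Qed.

End GaussEquation.

(** * Curvature in an orthonormal frame *)

Section FrameCurvature.
Variables (R : realType) (m n : nat) (M : smooth_manifold R m).
Variables (g : riemannian_metric M) (D : tangent_subbundle M n).
Variables (nabla : vfield M -> vfield M -> vfield M) (U : vfield M) (c : R).
Variables (W : set M) (p : M) (E : 'I_n -> vfield M).
Hypotheses (oW : open W) (Wp : W p) (hLC : levi_civita g nabla).
Hypotheses (sU : smooth_vfield_on W U) (fE : orthonormal_frame_on g D W E).
Hypothesis hc : constant_sectional_curvature g nabla c.

Local Notation tnabla := (semi_symmetric g nabla U).
Local Notation "<< u , v >>" := (inner g p u v).
Local Notation al i j := (alpha g nabla U (E i) (E j) p).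
Local Notation B i j := (second_form g D nabla (E i) (E j) p).
Local Notation tB i j := (second_form g D tnabla (E i) (E j) p).

Lemma inner_frame i j : <<E i p, E j p>> = (i == j)%:R.
Proof. exact: fE.2. Qed.

Lemma free_frame i j : i != j -> free [:: E i p; E j p].
Proof.
move=> ij; rewrite free_cons seq1_free; apply/andP; split.
  apply/negP; rewrite span_seq1 => /vlineP[k Eik].
  have := inner_frame i i; rewrite {1}Eik innerZl inner_frame.
  rewrite eqxx eq_sym (negPf ij) mulr0 => /eqP.
  by rewrite eq_sym oner_eq0.
apply/eqP => Ej0; have := inner_frame j j; rewrite Ej0 inner0l eqxx => /eqP.
by rewrite eq_sym oner_eq0.
Qed.

Lemma curvature_frame i j : i != j ->
  <<curvature nabla (E i) (E j) (E j) p, E i p>> = c.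
Proof.
move=> ij.
rewrite -(hc oW (fE.1 i).1 (fE.1 j).1 Wp (free_frame ij)) /sectional_curvature.
by rewrite /metric_of !inner_frame !eqxx (negPf ij) expr0n subr0 mulr1 divr1.
Qed.

(** For [i = j] the ambient curvature vanishes by antisymmetry and the values of
[alpha] cancel in pairs, which the factor (i != j) records; the sign of the last
term comes from exchanging the arguments of the bracket, as in the definition
of [AD]. *)
Lemma curvatureD_frame i j : curvatureD4 g D tnabla (E i) (E j) (E j) (E i) p =
  (i != j)%:R * (c - al i i - al j j) + <<tB j j, tB i i>> - <<tB i j, tB j i>>
  + <<B j i, lie_bracket (E j) (E i) p>>.
Proof.
have [conn tf _] := hLC.
have si := (fE.1 i).1; have sj := (fE.1 j).1.
rewrite (gauss_equation oW Wp hLC sU fE (fE.1 i) (fE.1 j) (fE.1 j) (fE.1 i)).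
rewrite (curvature_semi_symmetric oW Wp hLC sU si sj sj si).
have -> : lie_bracket (E i) (E j) p = - lie_bracket (E j) (E i) p.
  by rewrite opprB.
rewrite innerNr !inner_frame !eqxx.
have [->|ij] := eqVneq i j.
  have sL := smooth_lie_bracket oW conn tf sj sj.
  have := congr1 (fun v => <<v, E j p>>) (curvature_antisym oW conn Wp sL sj).
  rewrite /= innerNl => R0.
  have {}R0 : <<curvature nabla (E j) (E j) (E j) p, E j p>> = 0 by lra.
  by rewrite R0 /=; ring.
by rewrite (curvature_frame ij) /=; ring.
Qed.

Lemma planeK_frame i j : i != j -> planeK g D tnabla (E i) (E j) p =
  c - OmegaPlane g D nabla U (E i) (E j) p
  + <<tB i i, tB j j>> - <<tB i j, tB j i>>.
Proof.
move=> ij; have [conn tf _] := hLC.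
have si := (fE.1 i).1; have sj := (fE.1 j).1.
rewrite /planeK /OmegaPlane curvatureD_frame.
rewrite (gauss_equation oW Wp hLC sU fE (fE.1 i) (fE.1 j) (fE.1 i) (fE.1 j)).
rewrite (curvature_semi_symmetric oW Wp hLC sU si sj si sj).
rewrite (curvature_antisym oW conn Wp (smooth_lie_bracket oW conn tf si sj) si).
rewrite innerNl curvature_frame 1?eq_sym // !inner_frame !eqxx.
rewrite (eq_sym j i) (negPf ij) /metric_of /=.
have -> : lie_bracket (E j) (E i) p = - lie_bracket (E i) (E j) p.
  by rewrite opprB.
rewrite innerNr [<<B i j - _, _>>]innerDl innerNl.
rewrite (innerC _ _ (tB j j) (tB i i)) (innerC _ _ (tB j i) (tB i j)).
by field.
Qed.

End FrameCurvature.

Lemma sum_offdiagonal (R : comPzRingType) (n : nat) (c : R) (a : 'I_n -> R) :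
  \sum_i \sum_j (i != j)%:R * (c - a i - a j) =
  (n%:R - 1) * (n%:R * c - 2 * \sum_i a i).
Proof.
have row i : \sum_j (i != j)%:R * (c - a i - a j) =
    (n%:R - 1) * c - (n%:R - 2) * a i - \sum_j a j.
  rewrite (bigD1 i) //= eqxx mul0r add0r.
  under eq_bigr => j ji do rewrite eq_sym ji mul1r.
  have : \sum_j (c - a i - a j) = n%:R * c - n%:R * a i - \sum_j a j.
    by rewrite !sumrB !sumr_const card_ord !mulr_natl.
  rewrite (bigD1 i) //= => /(canRL (addKr _)) ->; ring.
under eq_bigr do rewrite row.
rewrite !sumrB !sumr_const card_ord -mulr_sumr.
rewrite -[X in X - _ - _]mulr_natl -[X in _ - X]mulr_natl; ring.
Qed.

Theorem theorem2p10 (R : realType) (m n : nat) (M : smooth_manifold R m)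
    (g : riemannian_metric M) (nabla : vfield M -> vfield M -> vfield M)
    (D : tangent_subbundle M n) (U : vfield M) (c : R)
    (hn : (2 < n)%N)
    (hLC : levi_civita g nabla)
    (hD : non_integrable D)
    (hU : smooth_vfield_on setT U)
    (hc : constant_sectional_curvature g nabla c)
    (p : M) (Pi : 'M[R]_m) (hPi2 : \rank Pi = 2%N) (hPiD : (Pi <= D p)%MS)
    (W : set M) (hW : open_nbhs p W)
    (E : 'I_n -> vfield M) (hE : orthonormal_frame_on g D W E) :
  let E1 := E (Ordinal (ltnW (ltnW hn))) in
  let E2 := E (Ordinal (ltnW hn)) in
  let tnabla := semi_symmetric g nabla U in
  let H := mean_curvature g D tnabla E in
  (col_mx (E1 p) (E2 p) == Pi)%MS ->
  scalarD g D tnabla E p - planeK g D tnabla E1 E2 p <=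
    (n%:R + 1) * (n%:R - 2) / 2 * c
    - (n%:R - 1) * lambda g nabla U E p
    + AD g D nabla E p
    + OmegaPlane g D nabla U E1 E2 p
    + n%:R ^+ 2 * (n%:R - 2) / (2 * (n%:R - 1)) * metric_of g H H p
    + 2^-1 * second_form_normsq g D tnabla E p.
Proof.
move=> E1 E2 tnabla H _; rewrite {}/E1 {}/E2.
have [oW Wp] := hW; have sU := smooth_vfieldS (@subsetT _ W) hU.
set i1 := Ordinal _; set i2 := Ordinal _; have i12 : i1 != i2 by [].
pose b i j := second_form g D tnabla (E i) (E j) p.
have HE : metric_of g H H p =
    n%:R^-1 * (n%:R^-1 * inner g p (\sum_i b i i) (\sum_i b i i)).
  by rewrite -innerZr -innerZl.
have tauE : scalarD g D tnabla E p =
   ((n%:R - 1) * (n%:R * c - 2 * lambda g nabla U E p)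
    + inner g p (\sum_i b i i) (\sum_i b i i)
    - \sum_i \sum_j inner g p (b i j) (b j i)) / 2 + AD g D nabla E p.
  rewrite /scalarD /AD -mulrDl; congr (_ / 2).
  rewrite -sum_offdiagonal inner_suml -!big_split /= -sumrB -big_split /=.
  apply: eq_bigr => i _.
  rewrite innerC inner_suml -!big_split /= -sumrB -big_split /=.
  by apply: eq_bigr => j _; exact: (curvatureD_frame oW Wp hLC sU hE hc).
rewrite tauE (planeK_frame oW Wp hLC sU hE hc i12) HE.
have i21 : i2 != i1 by [].
have := plane_diagonal_inequality g p b hn i21.
have := plane_symmetric_inequality g p b i21.
(* The diagonal bound is used with weight 1/2, the symmetric one with weight 1;
   the excess sum_i |b_ii|^2 / 2 is discarded. *)
have : 0 <= \sum_i inner g p (b i i) (b i i).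
  by apply: sumr_ge0 => i _; exact: inner_ge0.
rewrite -/(b i1 i1) -/(b i1 i2) -/(b i2 i1) -/(b i2 i2).
have -> : second_form_normsq g D tnabla E p =
  \sum_i \sum_j inner g p (b i j) (b i j) by [].
move: (\sum_i inner g p (b i i) (b i i)) (inner g p (\sum_i b i i) _) => s0 s1.
move: (\sum_i \sum_j _) (\sum_i \sum_j _) => s2 s3.
move: (inner _ _ _ _) (inner _ _ _ _) => x12 x22.
move: (lambda _ _ _ _ _) (AD _ _ _ _ _) (OmegaPlane _ _ _ _ _ _ _) => l a o.
have N2 : 2 < n%:R :> R by rewrite ltr_nat.
move: (n%:R : R) N2 => N N2.
have -> : N ^+ 2 * (N - 2) / (2 * (N - 1)) * (N^-1 * (N^-1 * s1)) =
    s1 / 2 - s1 / (N - 1) / 2.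
  by field; rewrite !gt_eqF //; lra.
move: (s1 / (N - 1)) => q.
lra.
Qed.
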